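(* Let $1 \le a < b \le c < e < d$ be integers such that $e \le 2b$ and $2c \le a+d$. Let $R = k[x^{\alpha}y^{d-\alpha} \mid \alpha \in [0,a] \cup [b,c] \cup [e,d]]$ and $Q = (x^d,y^d)$. Then $$r_Q(R_+) = \max\left\{\left\lceil\frac{b-1}{a}\right\rceil, \left\lceil\frac{e-c+a-1}{a}\right\rceil, \left\lceil\frac{d-c-1}{d-e}\right\rceil, \left\lceil\frac{d-e+b-a-1}{d-e}\right\rceil\right\}.$$
   Context: $k$ is a field and $x,y$ are variables; $[p,q]$ denotes the set of integers $\alpha$ with $p \le \alpha \le q$. $R$ is the $k$-subalgebra of $k[x,y]$ generated by the indicated monomials of degree $d$, graded so that each of these generating monomials has degree $1$: $R = \bigoplus_{n\ge 0} R_n$, and $R_+ = \bigoplus_{n\ge 1} R_n$. $Q$ is the ideal of $R$ generated by $x^d$ and $y^d$. It is a reduction of $R_+$, and $r_Q(R_+)$ is the least integer $r \ge 0$ with $Q(R_+)^r = (R_+)^{r+1}$. *)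

(* Defs.v *)
From HB Require Import structures.
From mathcomp Require Import all_boot all_order all_algebra.
From mathcomp Require Import mpoly.

Set Implicit Arguments.
Unset Strict Implicit.
Unset Printing Implicit Defensive.

Import Order.TTheory GRing.Theory Num.Theory.
Local Open Scope ring_scope.

(* Subsets of an ambient commutative k-algebra S are predicates S -> Prop; a
   subalgebra R of S, its graded pieces and its ideals are all such subsets. *)
Section SubalgebrasAndIdeals.
Variables (k : fieldType) (S : comAlgType k).
Implicit Types (A G I J Q R X : S -> Prop).

Definition same_set X Y := forall f : S, X f <-> Y f.

Definition finite_sums X (f : S) : Prop :=
  exists s : seq S, (forall g, g \in s -> X g) /\ f = \sum_(g <- s) g.

Definition lin_span X : S -> Prop :=
  finite_sums (fun f => exists (c : k) (g : S), X g /\ f = c *: g).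

(* Prop-valued counterpart of GRing.subalg_closed. *)
Definition is_subalgebra A : Prop :=
  [/\ A 1,
      forall (c : k) (u v : S), A u -> A v -> A (c *: u + v)
    & forall u v : S, A u -> A v -> A (u * v)].

Definition generated_subalgebra G (f : S) : Prop :=
  forall A, is_subalgebra A -> (forall g, G g -> A g) -> A f.

Definition products G (n : nat) (f : S) : Prop :=
  exists t : n.-tuple S,
    (forall i, G (tnth t i)) /\ f = \prod_(i < n) tnth t i.

(* The degree n component when every element of G is given degree 1. *)
Definition graded_piece G (n : nat) : S -> Prop := lin_span (products G n).

Definition positive_part G : S -> Prop :=
  finite_sums (fun f => exists n : nat, (1 <= n)%N /\ graded_piece G n f).

(* The ideal of R (not of S) generated by X. *)
Definition generated_ideal R X : S -> Prop :=
  finite_sums (fun f => exists r g : S, [/\ R r, X g & f = r * g]).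

Definition ideal_mul I J : S -> Prop :=
  finite_sums (fun f => exists g h : S, [/\ I g, J h & f = g * h]).

(* Powers of an ideal I of R; the zeroth power is the unit ideal R. *)
Definition ideal_exp R I (n : nat) : S -> Prop := iter n (ideal_mul I) R.

Definition reduction_eq R Q I (r : nat) : Prop :=
  same_set (ideal_mul Q (ideal_exp R I r)) (ideal_exp R I r.+1).

(* r is the reduction number of I with respect to Q, as ideals of R. *)
Definition is_reduction_number R Q I (r : nat) : Prop :=
  reduction_eq R Q I r /\ forall s : nat, reduction_eq R Q I s -> (r <= s)%N.

End SubalgebrasAndIdeals.

Section MonomialAlgebras.
Variables (k : fieldType) (d : nat) (E : pred nat).

Definition var_x : {mpoly k[2]} := 'X_ord0.
Definition var_y : {mpoly k[2]} := 'X_ord_max.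

(* Used only for E contained in [0, d], so that d - alpha is not truncated. *)
Definition monomial_gens (f : {mpoly k[2]}) : Prop :=
  exists alpha : nat, E alpha /\ f = var_x ^+ alpha * var_y ^+ (d - alpha).

Definition monomial_algebra : {mpoly k[2]} -> Prop :=
  generated_subalgebra monomial_gens.

Definition monomial_algebra_plus : {mpoly k[2]} -> Prop :=
  positive_part monomial_gens.

Definition xd_yd_ideal : {mpoly k[2]} -> Prop :=
  generated_ideal monomial_algebra
    (fun f => f = var_x ^+ d \/ f = var_y ^+ d).

End MonomialAlgebras.

Arguments monomial_algebra : clear implicits.
Arguments monomial_algebra_plus : clear implicits.
Arguments xd_yd_ideal : clear implicits.

Definition three_intervals (a b c e d : nat) : pred nat :=
  fun alpha => [|| alpha <= a, b <= alpha <= c | e <= alpha <= d]%N.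

(* Main.v *)
Require Import Defs.
From HB Require Import structures.
From mathcomp Require Import all_boot all_order all_algebra.
From mathcomp Require Import mpoly.
From mathcomp Require Import zify.

(* Every ideal involved is spanned by monomials, so Q (R_+)^r = (R_+)^(r+1)
   amounts to the equality (r+1)E = rE + {0, d} of iterated sumsets of
   E = [0,a] u [b,c] u [e,d].  Since [2b,2c] is contained in [e,a+d], nE is the
   union of the intervals [je, (n-j)a + jd] and [b + je, c + (n-1-j)a + jd].
   Comparing them, the only points of (r+1)E that can be missed are
   ra + 1 (if ra + 1 < b), c + (r-1)a + 1 (if it is < e), and the points arising
   from these under the symmetry alpha <-> d - alpha of the data; each of the
   four resulting conditions on r is one of the four ceilings. *)

Set Implicit Arguments.
Unset Strict Implicit.
Unset Printing Implicit Defensive.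

Import Order.TTheory GRing.Theory Num.Theory.
Local Open Scope ring_scope.

(** * Finite sums, ideal products and products of generators *)

Section FiniteSums.
Variables (k : fieldType) (S : comAlgType k).
Implicit Types (X Y I J K : S -> Prop) (f g : S).

Lemma finite_sums_ind X K f :
    K 0 -> (forall g h, K g -> K h -> K (g + h)) -> (forall g, X g -> K g) ->
  finite_sums X f -> K f.
Proof.
move=> K0 KD XK [s [Xs ->]]; elim: s Xs => [|g s IHs] Xs; first by rewrite big_nil.
rewrite big_cons; apply: KD; first by apply/XK/Xs; rewrite mem_head.
by apply: IHs => h hs; apply: Xs; rewrite inE hs orbT.
Qed.

Lemma finite_sums_sum (T : eqType) X (r : seq T) (F : T -> S) :
  (forall i, i \in r -> X (F i)) -> finite_sums X (\sum_(i <- r) F i).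
Proof.
move=> XF; exists (map F r); split; last by rewrite big_map.
by move=> g /mapP [i ir ->]; apply: XF.
Qed.

Lemma finite_sums_gen X f : X f -> finite_sums X f.
Proof.
by move=> Xf; exists [:: f]; rewrite big_seq1; split=> // g; rewrite inE => /eqP ->.
Qed.

Lemma finite_sums_sub X Y f :
  (forall g, X g -> Y g) -> finite_sums X f -> finite_sums Y f.
Proof. by move=> XY [s [Xs ->]]; exists s; split=> // g /Xs /XY. Qed.

Lemma eq_ideal_mul I I' J J' :
  same_set I I' -> same_set J J' -> same_set (ideal_mul I J) (ideal_mul I' J').
Proof.
move=> eI eJ f; split; apply: finite_sums_sub => _ [g [h [Ig Jh ->]]];
  by exists g, h; split=> //; [apply/eI | apply/eJ].
Qed.

Lemma productsS X n f :
  products X n.+1 f <-> exists g h, [/\ X g, products X n h & f = g * h].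
Proof.
split=> [[t [Xt ->]] | [g [_ [Xg [t [Xt ->]] ->]]]].
  exists (tnth t ord0), (\prod_(i < n) tnth [tuple of behead t] i).
  split; first exact: Xt.
    by exists [tuple of behead t]; split=> // i; rewrite tnth_behead; apply: Xt.
  rewrite big_ord_recl; congr (_ * _).
  apply: eq_bigr => i _; rewrite tnth_behead; congr (tnth _ _).
  by apply: val_inj; rewrite /= inordK // ltnS ltn_ord.
exists [tuple of g :: t]; split=> [i|].
  by case: (unliftP ord0 i) => [j|] ->; rewrite ?tnthS ?tnth0.
rewrite big_ord_recl tnth0; congr (_ * _).
by apply: eq_bigr => i _; rewrite tnthS.
Qed.

Lemma products0 X f : products X 0 f <-> f = 1.
Proof.
split=> [[t [_ ->]] | ->]; first by rewrite big_ord0.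
by exists [tuple]; split=> [[]|] //; rewrite big_ord0.
Qed.

End FiniteSums.

(** * Subspaces of a polynomial ring spanned by monomials *)

Section MonomialSpans.
Variables (k : fieldType) (n : nat).
Implicit Types (P : 'X_{1..n} -> Prop) (f g : {mpoly k[n]}).

(** The span of the monomials with exponent in [P], encoded by a condition on the support so that
    membership is checked one monomial at a time. *)
Definition monomial_span P f : Prop := forall m, m \in msupp f -> P m.

Definition mnm_sums P P' (m : 'X_{1..n}) : Prop :=
  exists m1 m2, [/\ P m1, P' m2 & m = (m1 + m2)%MM].

Lemma monomial_span0 P : monomial_span P 0.
Proof. by move=> m; rewrite msupp0. Qed.

Lemma monomial_spanD P f g :
  monomial_span P f -> monomial_span P g -> monomial_span P (f + g).
Proof. by move=> Pf Pg m /msuppD_le; rewrite mem_cat => /orP[/Pf|/Pg]. Qed.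

Lemma monomial_spanZ P (c : k) f : monomial_span P f -> monomial_span P (c *: f).
Proof. by move=> Pf m /msuppZ_le /Pf. Qed.

Lemma monomial_spanX P m : monomial_span P 'X_[m] <-> P m.
Proof.
split=> [PX | Pm m']; first by apply: PX; rewrite msuppX mem_seq1.
by rewrite msuppX mem_seq1 => /eqP ->.
Qed.

Lemma monomial_spanM P P' f g :
  monomial_span P f -> monomial_span P' g -> monomial_span (mnm_sums P P') (f * g).
Proof.
move=> Pf Pg m /msuppM_le /allpairsP [[m1 m2] /= [/Pf P1 /Pg P2 ->]].
by exists m1, m2.
Qed.

Lemma monomial_span_sub P P' f :
  (forall m, P m -> P' m) -> monomial_span P f -> monomial_span P' f.
Proof. by move=> PP' Pf m /Pf /PP'. Qed.

Lemma monomial_span_finite_sums P (X : {mpoly k[n]} -> Prop) f :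
  (forall g, X g -> monomial_span P g) -> finite_sums X f -> monomial_span P f.
Proof.
by move=> XP; apply: finite_sums_ind => //;
  [exact: monomial_span0 | exact: monomial_spanD].
Qed.

Lemma finite_sums_monomial_span P (X : {mpoly k[n]} -> Prop) f :
  (forall c m, P m -> X (c *: 'X_[m])) -> monomial_span P f -> finite_sums X f.
Proof.
move=> PX Pf; rewrite [f]mpolyE; apply: finite_sums_sum => m mf.
exact/PX/Pf.
Qed.

Lemma eq_monomial_span P P' :
  same_set (monomial_span P) (monomial_span P') <-> forall m, P m <-> P' m.
Proof.
split=> [ePP' m | ePP' f]; last by split; apply: monomial_span_sub => m /ePP'.
by have := ePP' 'X_[m]; rewrite !monomial_spanX.
Qed.

(** Products of ideals become sums of exponent sets. For the inclusion from right to left, a single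
    term with exponent [m1 + m2] is already one product, the scalar going to the first factor. *)
Lemma ideal_mul_monomial_span P P' :
  same_set (ideal_mul (monomial_span P) (monomial_span P'))
           (monomial_span (mnm_sums P P')).
Proof.
move=> f; split.
  by apply: monomial_span_finite_sums => _ [g [h [Pg Ph ->]]]; apply: monomial_spanM.
apply: finite_sums_monomial_span => c _ [m1 [m2 [P1 P2 ->]]].
exists (c *: 'X_[m1]), 'X_[m2]; rewrite -scalerAl mpolyXD; split=> //.
  by apply: monomial_spanZ; apply/monomial_spanX.
by apply/monomial_spanX.
Qed.

End MonomialSpans.

(** * Iterated sumsets of a set of natural numbers *)

Fixpoint sumset (E : pred nat) (n : nat) (alpha : nat) : Prop :=
  if n is n'.+1 then
    exists beta gamma, [/\ E beta, sumset E n' gamma & alpha = (beta + gamma)%N]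
  else alpha = 0%N.

Section Sumsets.
Variable E : pred nat.

Lemma sumsetD m n alpha :
  sumset E (m + n) alpha <->
  exists beta gamma, [/\ sumset E m beta, sumset E n gamma & alpha = (beta + gamma)%N].
Proof.
elim: m alpha => [|m IHm] alpha /=.
  split=> [sa | [_ [g [-> sg ->]]]] //; by exists 0%N, alpha.
split=> [[b [c [Eb /IHm [b' [c' [sb' sc' ->]]] ->]]]
        | [_ [c [[b [b' [Eb sb' ->]]] sc ->]]]].
  exists (b + b')%N, c'; split=> //; last by rewrite addnA.
  by exists b, b'.
exists b, (b' + c)%N; split=> //; last by rewrite addnA.
by apply/IHm; exists b', c.
Qed.

Lemma sumset_bound d n alpha :
  (forall beta, E beta -> beta <= d)%N -> sumset E n alpha -> (alpha <= n * d)%N.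
Proof.
move=> Ed; elim: n alpha => [|n IHn] alpha /=; first by move->.
by move=> [b [c [/Ed bd /IHn cn ->]]]; rewrite mulSn leq_add.
Qed.

End Sumsets.

(** * From the reduction equation to iterated sumsets *)

Section MonomialAlgebra.
Variables (k : fieldType) (d : nat) (E : pred nat).
Hypotheses (d_gt0 : (0 < d)%N) (E_le : forall alpha, E alpha -> (alpha <= d)%N).
Hypotheses (E0 : E 0%N) (Ed : E d).

Local Notation G := (@monomial_gens k d E).
Local Notation R := (monomial_algebra k d E).
Local Notation Rplus := (monomial_algebra_plus k d E).
Local Notation Q := (xd_yd_ideal k d E).

Definition mnm2 (i j : nat) : 'X_{1..2} := [multinom if val l == 0%N then i else j | l < 2].

Lemma mnm2_0 i j : mnm2 i j ord0 = i. Proof. by rewrite mnmE. Qed.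

Lemma mdeg_mnm2 i j : mdeg (mnm2 i j) = (i + j)%N.
Proof. by rewrite mdegE big_ord_recl big_ord1 !mnmE. Qed.

Lemma mnm2P (m m' : 'X_{1..2}) : m ord0 = m' ord0 -> mdeg m = mdeg m' -> m = m'.
Proof.
rewrite !mdegE !big_ord_recl !big_ord0 !addn0 => e0 e1.
apply/mnmP => i; case: (unliftP ord0 i) => [j|] -> //.
by rewrite (ord1 j); move: e1; rewrite e0 => /addnI.
Qed.

Lemma var_xyE i j : var_x k ^+ i * var_y k ^+ j = 'X_[mnm2 i j].
Proof.
rewrite /var_x /var_y !mpolyXn -mpolyXD; congr 'X_[_].
by apply/mnmP => l; rewrite mnmDE !mulmnE !mnm1E mnmE; case: l => [[|[|]]] //= ?;
  rewrite ?mul1n ?mul0n ?addn0.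
Qed.

(** Exponents of the monomials in the graded piece [R_n]. The total degree [n * d] determines the
    exponent of y, so only that of x is constrained. *)
Definition in_degree n (m : 'X_{1..2}) : Prop :=
  mdeg m = (n * d)%N /\ sumset E n (m ord0).

(** Exponents of the monomials in the power [(R_+)^r], which is the sum of the [R_n] with
    [n >= r]. *)
Definition in_degree_ge r (m : 'X_{1..2}) : Prop :=
  exists2 n, (r <= n)%N & in_degree n m.

Lemma in_degreeD m n u :
  in_degree (m + n) u <-> mnm_sums (in_degree m) (in_degree n) u.
Proof.
split=> [[du /sumsetD [b [c [sb sc ebc]]]] | [v [w [[dv sv] [dw sw] ->]]]]; last first.
  rewrite /in_degree mdegD dv dw mulnDl mnmDE; split=> //.
  by apply/sumsetD; exists (v ord0), (w ord0).
(* These bounds make the exponents of y in the two witnesses exact differences. *)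
have lb := sumset_bound E_le sb; have lc := sumset_bound E_le sc.
exists (mnm2 b (m * d - b)), (mnm2 c (n * d - c)).
split; rewrite /in_degree ?mnm2_0 ?mdeg_mnm2 ?subnKC //.
by apply: mnm2P; rewrite ?mnmDE ?mnm2_0 // mdegD !mdeg_mnm2 !subnKC // -mulnDl.
Qed.

Lemma monomial_gensE f : G f <-> exists2 m, in_degree 1 m & f = 'X_[m].
Proof.
split=> [[al [Eal ->]] | [m [dm [b [c [Eb -> eb]]]] ->]].
  exists (mnm2 al (d - al)); last by rewrite var_xyE.
  rewrite /in_degree mdeg_mnm2 mnm2_0 subnKC ?E_le // mul1n; split=> //.
  by exists al, 0%N; rewrite addn0.
exists b; split=> //; rewrite var_xyE; congr 'X_[_].
by apply: mnm2P; rewrite ?mnm2_0 ?mdeg_mnm2 ?subnKC ?E_le //; lia.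
Qed.

Lemma products_monomial_gensE n f :
  products G n f <-> exists2 m, in_degree n m & f = 'X_[m].
Proof.
elim: n f => [|n IHn] f.
  rewrite products0; split=> [->|[m [dm _] ->]].
    by exists 0%MM; rewrite ?mpolyX0 // /in_degree mdeg0 mnmE.
  by move/eqP: dm; rewrite mul0n mdeg_eq0 => /eqP ->; rewrite mpolyX0.
rewrite productsS; split.
  move=> [g [h [/monomial_gensE [u du ->] /IHn [v dv ->] ->]]].
  exists (u + v)%MM; last by rewrite mpolyXD.
  by apply/(@in_degreeD 1); exists u, v.
move=> [m /(@in_degreeD 1) [u [v [du dv ->]]] ->].
exists 'X_[u], 'X_[v]; rewrite mpolyXD; split=> //.
  by apply/monomial_gensE; exists u.
by apply/IHn; exists v.
Qed.

Lemma mnm_sums_in_degree_ge r s m :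
  mnm_sums (in_degree_ge r) (in_degree_ge s) m <-> in_degree_ge (r + s) m.
Proof.
split=> [[u [v [[i ri du] [j sj dv] ->]]] | [n rsn dm]].
  by exists (i + j)%N; [exact: leq_add | apply/in_degreeD; exists u, v].
have [i ri en] : exists2 i, (r <= i)%N & n = (i + s)%N.
  by exists (n - s)%N; lia.
move: dm; rewrite en => /in_degreeD [u [v [du dv ->]]].
by exists u, v; split=> //; [exists i | exists s].
Qed.

Lemma is_subalgebra_degree_ge0 : is_subalgebra (@monomial_span k 2 (in_degree_ge 0)).
Proof.
split.
- rewrite -mpolyX0; apply/monomial_spanX; exists 0%N => //.
  by rewrite /in_degree mdeg0 mnmE.
- by move=> c u v su sv; apply: monomial_spanD => //; apply: monomial_spanZ.
- move=> u v su sv; apply: (monomial_span_sub _ (monomial_spanM su sv)) => m.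
  by move/mnm_sums_in_degree_ge.
Qed.

Lemma monomial_algebraE : same_set R (monomial_span (in_degree_ge 0)).
Proof.
move=> f; split.
  apply; first exact: is_subalgebra_degree_ge0.
  by move=> g /monomial_gensE [m dm ->]; apply/monomial_spanX; exists 1%N.
move=> sf A [A1 AZD AM] GA.
(* Zero is reached as [(-1) *: 1 + 1]. *)
have A0 : A 0 by rewrite -(subrr 1) addrC -scaleN1r; apply: AZD.
have AD g h : A g -> A h -> A (g + h).
  by move=> Ag Ah; rewrite -[g]scale1r; apply: AZD.
have Aprod n g : products G n g -> A g.
  elim: n g => [|n IHn] g; first by move/products0 ->.
  by move/productsS => [u [v [/GA Au /IHn Av ->]]]; apply: AM.
suff : finite_sums A f by apply: finite_sums_ind.
apply: finite_sums_monomial_span sf => c m [n _ dm].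
rewrite -[_ *: _]addr0; apply: AZD => //.
by apply: (Aprod n); apply/products_monomial_gensE; exists m.
Qed.

Lemma monomial_algebra_plusE : same_set Rplus (monomial_span (in_degree_ge 1)).
Proof.
move=> f; split.
  apply: monomial_span_finite_sums => g [n [n_gt0 ng]].
  apply: monomial_span_finite_sums ng => _ [c [_ [/products_monomial_gensE [m dm ->] ->]]].
  by apply: monomial_spanZ; apply/monomial_spanX; exists n.
apply: finite_sums_monomial_span => c m [n n_gt0 dm]; exists n; split=> //.
apply: finite_sums_gen; exists c, 'X_[m]; split=> //.
by apply/products_monomial_gensE; exists m.
Qed.

Lemma ideal_expE r : same_set (ideal_exp R Rplus r) (monomial_span (in_degree_ge r)).
Proof.
elim: r => [|r IHr]; first exact: monomial_algebraE.
move=> f; apply: iff_trans (eq_ideal_mul monomial_algebra_plusE IHr f) _.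
apply: iff_trans (ideal_mul_monomial_span _ _ f) _; move: f.
by apply/eq_monomial_span => m; apply: mnm_sums_in_degree_ge.
Qed.

Definition pure_power (m : 'X_{1..2}) : Prop := m = mnm2 d 0 \/ m = mnm2 0 d.

Lemma xd_yd_idealE :
  same_set Q (monomial_span (mnm_sums (in_degree_ge 0) pure_power)).
Proof.
have powE f : f = var_x k ^+ d \/ f = var_y k ^+ d <->
    exists2 m, pure_power m & f = 'X_[m].
  have := var_xyE 0 d; have := var_xyE d 0; rewrite !expr0 mulr1 mul1r => -> ->.
  split=> [[->|->]|[m [->|->] ->]]; [| |by left|by right].
    by exists (mnm2 d 0) => //; left.
  by exists (mnm2 0 d) => //; right.
move=> f; split.
  apply: monomial_span_finite_sums => _ [r [_ [/monomial_algebraE Rr /powE [m pm ->] ->]]].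
  by apply: monomial_spanM => //; apply/monomial_spanX.
apply: finite_sums_monomial_span => c _ [u [v [du pv ->]]].
exists (c *: 'X_[u]), 'X_[v]; rewrite -scalerAl mpolyXD; split=> //.
  by apply/monomial_algebraE; apply: monomial_spanZ; apply/monomial_spanX.
by apply/powE; exists v.
Qed.

(* Equality in degree [r + 1] propagates to all higher degrees because
   [(n + 1)E = E + nE]. *)
Lemma reduction_eqP r :
  reduction_eq R Q Rplus r <->
  forall alpha, sumset E r.+1 alpha ->
    sumset E r alpha \/ exists2 beta, sumset E r beta & alpha = (d + beta)%N.
Proof.
have QIE : same_set (ideal_mul Q (ideal_exp R Rplus r))
    (monomial_span (mnm_sums (mnm_sums (in_degree_ge 0) pure_power) (in_degree_ge r))).
  move=> f; apply: iff_trans (eq_ideal_mul xd_yd_idealE (@ideal_expE r) f) _.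
  exact: ideal_mul_monomial_span.
have pureE m : pure_power m -> in_degree 1 m.
  case=> ->; rewrite /in_degree mdeg_mnm2 mnm2_0 ?addn0 mul1n; split=> //.
    by exists d, 0%N; rewrite addn0.
  by exists 0%N, 0%N.
(* One inclusion holds for every [r], since the two generators of Q have degree 1; only the reverse
   one constrains [r]. *)
have sub m : mnm_sums (mnm_sums (in_degree_ge 0) pure_power) (in_degree_ge r) m ->
    in_degree_ge r.+1 m.
  move=> [_ [w [[u [v [du /pureE dv ->]]] dw ->]]].
  rewrite -add1n; apply/mnm_sums_in_degree_ge; exists (u + v)%MM, w; split=> //.
  by apply/(@mnm_sums_in_degree_ge 0 1); exists u, v; split=> //; exists 1%N.
have -> : reduction_eq R Q Rplus r <-> forall m, in_degree_ge r.+1 m ->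
    mnm_sums (mnm_sums (in_degree_ge 0) pure_power) (in_degree_ge r) m.
  split=> [eqr m dm | le f].
    apply/(monomial_spanX k)/QIE/eqr/(@ideal_expE r.+1)/monomial_spanX.
    exact: dm.
  split=> [/QIE sf | /(@ideal_expE r.+1) sf].
    by apply/(@ideal_expE r.+1)/(monomial_span_sub sub).
  exact/QIE/(monomial_span_sub le).
split=> [le al sal | le].
  have al_le : (al <= r.+1 * d)%N by apply: sumset_bound sal.
  have [|_ [w [[u [v [[i _ du] pv ->]]] [j rj dw]]]] := le (mnm2 al (r.+1 * d - al)).
    by exists r.+1 => //; rewrite /in_degree mdeg_mnm2 mnm2_0 subnKC.
  move=> em; have /(congr1 mdeg) := em.
  have [du' su] := du; have [dw' sw] := dw; have [dv' _] := pureE _ pv.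
  (* Comparing total degrees gives [r + 1 = i + 1 + j] with [r <= j]. So the coefficient in R has
     degree 0, and the monomial is a pure power times one of degree exactly [r]. *)
  rewrite mdeg_mnm2 subnKC // !mdegD du' dv' dw' -!mulnDl => /eqP.
  rewrite eqn_pmul2r // => /eqP en.
  have [i0 ej] : i = 0%N /\ j = r by lia.
  move: su sw; rewrite i0 ej /= => u0 sw.
  have := congr1 (fun m : 'X_{1..2} => m ord0) em.
  rewrite /= !mnmDE mnm2_0 u0 => ->.
  case: pv => ->; rewrite mnm2_0; last by left.
  by right; exists (w ord0).
have base m : in_degree r.+1 m -> mnm_sums pure_power (in_degree r) m.
  move=> [dm /le sm].
  have cut b (v := mnm2 b (d - b)) :
      (b <= d)%N -> pure_power v -> (exists2 c, sumset E r c & m ord0 = (b + c)%N) ->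
      mnm_sums pure_power (in_degree r) m.
    move=> bd pv [c sc mc]; have cr := sumset_bound E_le sc.
    exists v, (mnm2 c (r * d - c)); rewrite /in_degree mdeg_mnm2 mnm2_0 subnKC //.
    split=> //; apply: mnm2P; rewrite ?mnmDE ?mnm2_0 // mdegD !mdeg_mnm2 !subnKC //.
  case: sm => [sm | sm]; last by apply: (cut d) => //; rewrite subnn; left.
  by apply: (cut 0%N) => //; [rewrite subn0; right | exists (m ord0)].
move=> m [n rn dm].
(* A monomial of degree [i + (r + 1)] splits off a factor of degree [r + 1], to which [base]
   applies; the factor of degree [i] is absorbed into Q. *)
have [i en] : exists i, n = (i + r.+1)%N by exists (n - r.+1)%N; lia.
move: dm; rewrite en => /in_degreeD [u [_ [du /base [v [w [pv dw ->]]] ->]]].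
exists (u + v)%MM, w; split; [| by exists r | by rewrite addmA].
by exists u, v; split=> //; exists i.
Qed.

End MonomialAlgebra.

(** * Sumsets of the three intervals *)

Section ThreeIntervals.
Variables (a b c e d : nat).
Hypotheses (ha : (1 <= a)%N) (hab : (a < b)%N) (hbc : (b <= c)%N) (hce : (c < e)%N).
Hypotheses (hed : (e < d)%N) (he2b : (e <= 2 * b)%N) (h2c : (2 * c <= a + d)%N).

Local Notation E := (three_intervals a b c e d).

(* At most one summand is taken from [[b, c]], since
   [[2b, 2c]] is contained in [[e, a + d]]. *)
Lemma sumset_three_intervals n al :
  sumset E n al <->
  (exists i j, [/\ i + j = n, j * e <= al & al <= i * a + j * d]%N) \/
  (exists i j, [/\ (i + j).+1 = n, b + j * e <= al & al <= c + i * a + j * d]%N).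
Proof.
have interval_sum l1 u1 l2 u2 x : (l1 <= u1 -> l2 <= u2 -> l1 + l2 <= x <= u1 + u2 ->
    exists y z, [/\ l1 <= y <= u1, l2 <= z <= u2 & x = y + z])%N.
  move=> h1 h2 hx; case: (leqP (l1 + u2) x) => hx'.
    by exists (x - u2)%N, u2; split; lia.
  by exists l1, (x - l1)%N; split; lia.
have A_sub i j x : (j * e <= x <= i * a + j * d)%N -> sumset E (i + j) x.
  elim: i x => [|i IHi] x hx.
    rewrite add0n in hx *; elim: j x hx => [|j IHj] x hx /=; first by lia.
    have [||| y [z [hy hz ->]]] := interval_sum e d (j * e)%N (j * d)%N x.
    - by lia.
    - by nia.
    - by lia.
    exists y, z; split=> //; last by apply: IHj; lia.
    by rewrite /three_intervals hy !orbT.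
  have [||| y [z [hy hz ->]]] := interval_sum 0%N a (j * e)%N (i * a + j * d)%N x.
  - by lia.
  - by nia.
  - by lia.
  exists y, z; split=> //; last exact: IHi.
  by rewrite /three_intervals; lia.
split=> [|[[i [j [<- h1 h2]]] | [i [j [<- h1 h2]]]]]; last 1 first.
- have [||| y [z [hy hz ->]]] := interval_sum b c (j * e)%N (i * a + j * d)%N al.
  + by lia.
  + by nia.
  + by lia.
  exists y, z; split=> //; last exact: A_sub.
  by rewrite /three_intervals hy orbT.
- elim: n al => [|n IHn] al /=; first by move=> ->; left; exists 0%N, 0%N.
  move=> [y [z [hy /IHn hz ->]]].
  case/or3P: hy => hy; case: hz => -[i [j [hn h1 h2]]].
  + by left; exists i.+1, j; split; lia.
  + by right; exists i.+1, j; split; lia.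
  + by right; exists i, j; split; lia.
  (* Two summands from [[b, c]] are traded for one from [[0, a]] and one from [[e, d]]; this is
     where [he2b] and [h2c] enter. *)
  + by left; exists i.+1, j.+1; split; lia.
  + by left; exists i, j.+1; split; lia.
  + by right; exists i, j.+1; split; lia.
- by apply: A_sub; rewrite h1 h2.
Qed.

(** The four ceilings are at most [r], with denominators cleared and negative terms moved across.
    The last two inequalities are the first two for the mirrored data
    [(d - e, d - c, d - b, d - a)]. *)
Definition reduction_bounds r : Prop :=
  [/\ b <= r * a + 1, e + a <= r * a + c + 1,
      d <= r * (d - e) + c + 1 & d + b <= r * (d - e) + e + a + 1]%N.

(** If a bound fails, an explicit point of [(r+1)E] is missed. If all hold, an interval of [(r+1)E]
    using both [[0, a]] and [[e, d]] is covered by an interval of [rE] and a translate by [d] of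
    another; the bounds close the gaps in the remaining extreme intervals. *)
Lemma sumset_step_reduction_bounds r :
  (forall al, sumset E r.+1 al ->
     sumset E r al \/ exists2 be, sumset E r be & al = (d + be)%N) <->
  reduction_bounds r.
Proof.
have [g g_gt0 ed] : exists2 g, (0 < g)%N & d = (e + g)%N by exists (d - e)%N; lia.
have a_le : (a <= e + g)%N by lia.
have E_le al : E al -> (al <= d)%N by rewrite /three_intervals; lia.
rewrite /reduction_bounds ed addKn -ed.
split=> [step | [h1 h2 h3 h4] al].
  have no_step al : sumset E r.+1 al -> ~ sumset E r al ->
      (forall be, al = d + be -> ~ sumset E r be)%N -> False.
    by move=> /step[//|[be sbe ->]] _ /(_ _ erefl).
  have h1 : (b <= r * a + 1)%N.
    rewrite leqNgt; apply/negP => h1.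
    apply: (no_step (r * a + 1)%N).
    - by apply/sumset_three_intervals; left; exists r.+1, 0%N; split; lia.
    - move/sumset_three_intervals => [] [i [[|j] [hij l u]]]; nia.
    - by move=> be; lia.
  (* As [b >= 2], [h1] excludes [r = 0]. Hence [e <= r * e], and the subtractions in the last two
     witnesses are exact. *)
  have r_gt0 : (0 < r)%N by case: (r) h1; lia.
  have re_ge := leq_pmull e r_gt0.
  split=> //; rewrite leqNgt; apply/negP => h.
  - apply: (no_step (r * a + c + 1 - a)%N).
    + by apply/sumset_three_intervals; right; exists r, 0%N; split; lia.
    + move/sumset_three_intervals => [] [i [[|j] [hij l u]]]; nia.
    + by move=> be; nia.
  - have rd : (r * d = r * e + r * g)%N by rewrite ed mulnDr.
    (* Mirror image of [r * a + 1] under [al -> (r + 1) * d - al]. It exceeds [r * d], and removing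
       [d] leaves the point just below [[r * e, r * d]]. *)
    apply: (no_step (d + (r * e - 1))%N).
    + by apply/sumset_three_intervals; left; exists 0%N, r.+1; split; nia.
    + by move/(sumset_bound E_le); rewrite rd; lia.
    + move=> be eb; have -> : be = (r * e - 1)%N by lia.
      move/sumset_three_intervals => [] [i [j [hij l u]]].
      * by case: i hij l u => [|i] hij l u; subst r d; last have := leq_mul (leqnn i) a_le; lia.
      * by case: i hij l u => [|i] hij l u; subst r d; last have := leq_mul (leqnn i) a_le; lia.
  - have rd : (r * d = r * e + r * g)%N by rewrite ed mulnDr.
    (* Mirror image of [c + (r - 1) * a + 1]; removing [d] leaves the point just below the interval
       that starts at [b + (r - 1) * e]. *)
    apply: (no_step (d + (r * e + b - e - 1))%N).
    + by apply/sumset_three_intervals; right; exists 0%N, r; split; nia.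
    + by move/(sumset_bound E_le); rewrite rd; lia.
    + move=> be eb; have -> : be = (r * e + b - e - 1)%N by lia.
      move/sumset_three_intervals => [] [i [j [hij l u]]].
      * by case: i hij l u => [|i] hij l u; subst r d; last have := leq_mul (leqnn i) a_le; lia.
      * by case: i hij l u => [|i] hij l u; subst r d; last have := leq_mul (leqnn i) a_le; lia.
(* From here on [r] is the predecessor of the original one: [al] lies in [(r+2)E] and is to be found
   in [(r+1)E] or its translate by [d]. *)
case: r h1 h2 h3 h4 => [|r] h1 h2 h3 h4; first by lia.
have rd : (r * d = r * e + r * g)%N by rewrite ed mulnDr.
have inA i j x : (i + j = r.+1 -> j * e <= x <= i * a + j * d -> sumset E r.+1 x)%N.
  by move=> hij /andP[l u]; apply/sumset_three_intervals; left; exists i, j.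
have inB i j x : (i + j = r -> b + j * e <= x <= c + i * a + j * d -> sumset E r.+1 x)%N.
  by move=> hij /andP[l u]; apply/sumset_three_intervals; right; exists i, j; rewrite hij.
set goal := _ \/ _.
have shift : (d <= al)%N -> sumset E r.+1 (al - d) -> goal.
  by move=> dal sal; right; exists (al - d)%N => //; lia.
have mid i j : (i + j = r -> j.+1 * e <= al <= i.+1 * a + j.+1 * d -> goal)%N.
  move=> hij hal; case: (leqP al (i * a + j.+1 * d)) => hal'.
    by left; apply: (inA i j.+1); lia.
  have jed : (j * e <= j * d)%N by rewrite leq_mul2l; lia.
  by apply: shift; [|apply: (inA i.+1 j)]; lia.
(* Past [c + r * a], the bound [h2] gives [e <= al], so [mid] takes over without a gap. *)
have low : (b <= al <= c + r.+1 * a -> goal)%N.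
  move=> hal; case: (leqP al (c + r * a)) => hal'.
    by left; apply: (inB r 0%N); lia.
  by apply: (mid r 0%N); lia.
(* Mirror of [low]: [h4] places everything below [d + b + r * e] within reach of [mid], and under
   the first alternative [h3] keeps [al - d] at most [c + r * d]. *)
have high : (r.+1 * e <= al <= d + r.+1 * d -> d + r.+1 * e > al \/ al <= c + r.+1 * d -> goal)%N.
  move=> hal hal'; case: (leqP (d + b + r * e) al) => hal2.
    by apply: shift; [|apply: (inB 0%N r)]; lia.
  by apply: (mid 0%N r); lia.
move/sumset_three_intervals => [] [i [j [hij l u]]].
- case: j hij l u => [|j] hij l u.
    (* Beyond [r.+1 * a], the bound [h1] gives [b <= al], so [low] applies. *)
    case: (leqP al (r.+1 * a)) => hal; first by left; apply: (inA r.+1 0%N); lia.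
    have ei : i = r.+2 by lia.
    by subst i; apply: low; lia.
  case: i hij l u => [|i] hij l u; last by apply: (mid i j); lia.
  have ej : j = r.+1 by lia.
  subst j; case: (leqP (d + r.+1 * e) al) => hal.
    by apply: shift; [|apply: (inA 0%N r.+1)]; lia.
  by apply: high; lia.
- case: j hij l u => [|j] hij l u.
    have ei : i = r.+1 by lia.
    by subst i; apply: low; lia.
  case: i hij l u => [|i] hij l u.
    have ej : j = r by lia.
    by subst j; apply: high; lia.
  case: (leqP al (c + i * a + j.+1 * d)) => hal.
    by left; apply: (inB i j.+1); lia.
  have jed : (j * e <= j * d)%N by rewrite leq_mul2l; lia.
  by apply: shift; [|apply: (inB i.+1 j)]; lia.
Qed.

End ThreeIntervals.

(** * From the four inequalities to the maximum of ceilings *)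

Theorem theorem6p2 (k : fieldType) (a b c e d : nat)
  (ha : (1 <= a)%N) (hab : (a < b)%N) (hbc : (b <= c)%N) (hce : (c < e)%N)
  (hed : (e < d)%N) (he2b : (e <= 2 * b)%N) (h2c : (2 * c <= a + d)%N) :
  exists r : nat,
    is_reduction_number
      (monomial_algebra k d (three_intervals a b c e d))
      (xd_yd_ideal k d (three_intervals a b c e d))
      (monomial_algebra_plus k d (three_intervals a b c e d)) r /\
    r%:Z =
      Num.max (Num.ceil ((b%:Q - 1) / a%:Q))
     (Num.max (Num.ceil ((e%:Q - c%:Q + a%:Q - 1) / a%:Q))
     (Num.max (Num.ceil ((d%:Q - c%:Q - 1) / (d%:Q - e%:Q)))
              (Num.ceil ((d%:Q - e%:Q + b%:Q - a%:Q - 1) / (d%:Q - e%:Q))))).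
Proof.
set M := Num.max _ _.
have ceil_le (p q r : nat) (x y : rat) : (0 < q)%N -> y = q%:Q ->
    x = p%:Q - 1 -> (Num.ceil (x / y) <= r%:Z) = (p <= r * q + 1)%N.
  move=> q_gt0 -> ->; rewrite ceil_le_int ler_pdivrMr ?ltr0z // lerBlDr.
  by rewrite -[1]/(1%:Q) -intrM -intrD ler_int; lia.
have addQ (m n : nat) : (m + n)%N%:Q = m%:Q + n%:Q by rewrite PoszD intrD.
have subQ (m n : nat) : (n <= m)%N -> (m - n)%N%:Q = m%:Q - n%:Q.
  by move=> nm; rewrite -subzn // intrB.
have hce' := ltnW hce; have hed' := ltnW hed; have hab' := ltnW hab.
have hcd' := leq_trans hce' hed'.
(* Each numerator is read as [p - 1] for a natural number [p]; the orderings of [a], [b], [c], [e],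
   [d] make the subtractions in [p] exact. *)
have M_le r : M <= r%:Z <-> reduction_bounds a b c e d r.
  rewrite /M !ge_max (@ceil_le b a) // (@ceil_le (e - c + a)%N a) //; last first.
    by rewrite addQ subQ.
  rewrite (@ceil_le (d - c)%N (d - e)%N) ?subn_gt0 ?subQ //.
  rewrite (@ceil_le (d - e + (b - a))%N (d - e)%N) ?subn_gt0 ?subQ //; last first.
    by rewrite addQ !subQ // addrA.
  by split=> [/and4P[h1 h2 h3 h4] | [h1 h2 h3 h4]];
    [split | apply/and4P; split]; lia.
(* The first ceiling is already nonnegative, so [M] is a natural number and can itself serve as
   [r]. *)
have M_ge0 : 0 <= M.
  rewrite le_max ceil_ge0; apply/orP; left.
  apply: (lt_le_trans (ltrN10 _)); apply: divr_ge0; last by rewrite ler0z.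
  by rewrite subr_ge0 -[1]/(1%:Q) ler_int; lia.
have redP r : reduction_eq (monomial_algebra k d (three_intervals a b c e d))
    (xd_yd_ideal k d (three_intervals a b c e d))
    (monomial_algebra_plus k d (three_intervals a b c e d)) r <-> M <= r%:Z.
  rewrite M_le -sumset_step_reduction_bounds //; apply: reduction_eqP.
  - by lia.
  - by move=> al; rewrite /three_intervals; lia.
  - by rewrite /three_intervals.
  - by rewrite /three_intervals; lia.
exists `|M|%N; rewrite gez0_abs //; split=> //; split=> [|s /redP].
  by apply/redP; rewrite gez0_abs.
by rewrite -lez_nat gez0_abs.
Qed.
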